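(* Let $(a_n)_{n\geqslant0}$ be a bounded sequence of integers with $a_n\geqslant2$ for all $n$, let $q_0=1$, $q_{n+1}=a_nq_n$, and let $f$ be a real-valued $Q$-additive function with respect to this Cantor numeration system such that the two series \[ \sum_{j\geqslant0}\frac1{a_j}\sum_{d=1}^{a_j-1}f(dq_j)\quad\text{and}\quad\sum_{j\geqslant0}\frac1{a_j}\sum_{d=1}^{a_j-1}f(dq_j)^2 \] converge and $f(dq_j)\neq0$ for infinitely many pairs $(d,j)$. Let $F$ be the limiting distribution function of $f$. For an integer $N\geqslant1$ let $L=L(N)=\max\{j\geqslant0: q_j\leqslant N<q_{j+1}\}$, let $a=\min_n a_n$, and for real $T\geqslant1$ let $h=\lceil\log_a(T\log T)\rceil$. Then for all real $T\geqslant1$ with $h\leqslant L(N)$, \[ \|F_N-F\|_\infty\ll Q_F\!\left(\frac1T\right)+T\left|\sum_{j>L}\frac1{a_j}\sum_{d=0}^{a_j-1}f(dq_j)\right|+T\sqrt h\sqrt{\sum_{j\geqslant L-h}\frac1{a_j}\sum_{d=0}^{a_j-1}f(dq_j)^2}, \] where all implicit constants depend on the minimum and maximum of $(a_n)_n$.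
   Context: Every nonnegative integer $n$ has a unique expansion $n=\sum_{j\geqslant0}\delta_j(n)q_j$ with $0\leqslant\delta_j(n)\leqslant a_j-1$. A function $f$ is $Q$-additive if $f(0)=0$ and $f(n)=\sum_{j\geqslant 0}f(\delta_j(n)q_j)$ for all $n$ (with $f(0\cdot q_j)=0$). $F_N(y)=\frac1N\#\{n<N: f(n)\leqslant y\}$, $F(y)=\lim_{N\to\infty}F_N(y)$, $\|\cdot\|_\infty$ is the sup norm over $y\in\mathbb{R}$, and $Q_F(h)=\sup_{z\in\mathbb{R}}(F(z+h)-F(z))$ for $h>0$.
   Formalization: The implicit constant in front of Q_F(1/T) may depend on f as well as on the minimum and maximum of (a_n), since with dependence on these two alone the bound is false; the constant of the other two terms depends only on the minimum and maximum. *)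

(* Defs.v *)
From HB Require Import structures.
From mathcomp Require Import all_boot all_order all_algebra.
From mathcomp Require Import all_classical all_reals all_analysis.

Set Implicit Arguments.
Unset Strict Implicit.
Unset Printing Implicit Defensive.

Import Order.TTheory GRing.Theory Num.Theory.
Import numFieldNormedType.Exports.

Local Open Scope classical_set_scope.
Local Open Scope ring_scope.

Definition is_seq_min (a : nat -> nat) (m : nat) : Prop :=
  (exists n, a n = m) /\ forall n, (m <= a n)%N.

Definition is_seq_max (a : nat -> nat) (m : nat) : Prop :=
  (exists n, a n = m) /\ forall n, (a n <= m)%N.

Fixpoint cantor_base (a : nat -> nat) (n : nat) : nat :=
  if n is k.+1 then (a k * cantor_base a k)%N else 1%N.

(* The digit delta_j(n); digit_lt, digit_expansion and digit_unique below show
   that these are the digits of the unique Cantor expansion of n. *)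
Definition digit (a : nat -> nat) (j n : nat) : nat :=
  ((n %/ cantor_base a j) %% a j)%N.

Lemma cantor_base_gt (a : nat -> nat) (ha : forall n, (2 <= a n)%N) (j : nat) :
  (j < cantor_base a j)%N.
Proof.
elim: j => //= j IHj.
by rewrite (leq_trans _ (leq_mul (ha j) IHj)) // mul2n -addnn addSn ltnS leq_addl.
Qed.

Lemma digit_lt (a : nat -> nat) (ha : forall n, (2 <= a n)%N) (j n : nat) :
  (digit a j n < a j)%N.
Proof. by rewrite ltn_mod (leq_trans _ (ha j)). Qed.

Lemma digit_expansion_mod (a : nat -> nat) (ha : forall n, (2 <= a n)%N)
    (k n : nat) :
  (\sum_(j < k) digit a j n * cantor_base a j)%N = (n %% cantor_base a k)%N.
Proof.
elim: k => [|k IHk]; first by rewrite big_ord0 modn1.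
rewrite big_ord_recr /= IHk /digit; set q := cantor_base a k.
have q0 : (0 < q)%N by apply: leq_ltn_trans (cantor_base_gt ha k).
have a0 : (0 < a k)%N by rewrite (leq_trans _ (ha k)).
have lt : (n %/ q %% a k * q + n %% q < a k * q)%N.
  apply: (@leq_trans ((n %/ q %% a k).+1 * q)).
    by rewrite mulSn addnC ltn_add2r ltn_mod.
  by rewrite leq_mul2r ltn_mod a0 orbT.
have En : (n %/ q %/ a k * (a k * q) + (n %/ q %% a k * q + n %% q) = n)%N.
  by rewrite addnA mulnA -mulnDl -!divn_eq.
by rewrite -[in RHS]En modnMDl (modn_small lt) addnC.
Qed.

Lemma digit_expansion (a : nat -> nat) (ha : forall n, (2 <= a n)%N) (n : nat) :
  n = (\sum_(j < n) digit a j n * cantor_base a j)%N.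
Proof. by rewrite (digit_expansion_mod ha) modn_small // cantor_base_gt. Qed.

Lemma digit_unique (a : nat -> nat) (ha : forall n, (2 <= a n)%N)
    (d : nat -> nat) (hd : forall j, (d j < a j)%N) (k j : nat) :
  (j < k)%N -> digit a j (\sum_(i < k) d i * cantor_base a i)%N = d j.
Proof.
have q0 i : (0 < cantor_base a i)%N by apply: leq_ltn_trans (cantor_base_gt ha i).
have lt i : (\sum_(l < i) d l * cantor_base a l < cantor_base a i)%N.
  elim: i => [|i IHi]; first by rewrite big_ord0.
  rewrite big_ord_recr /=.
  apply: (@leq_trans ((d i).+1 * cantor_base a i)).
    by rewrite mulSn ltn_add2r.
  by rewrite leq_mul2r hd orbT.
elim: k => // k IHk; rewrite ltnS leq_eqVlt => /predU1P[->|jk].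
  rewrite big_ord_recr /= /digit addnC divnMDl // (divn_small (lt k)) addn0.
  by rewrite modn_small.
rewrite big_ord_recr /= -[RHS](IHk jk) /digit.
have [c ->] : exists c, cantor_base a k = (c * (a j * cantor_base a j))%N.
  rewrite -[(a j * _)%N]/(cantor_base a j.+1).
  elim: k jk {IHk} => // k IHk; rewrite ltnS leq_eqVlt => /predU1P[->|/IHk[c Hc]].
    by exists 1%N; rewrite mul1n.
  by exists (a k * c)%N; rewrite /= Hc mulnA.
by rewrite addnC !mulnA divnMDl // modnMDl.
Qed.

(* The sum may be stopped at j = n since cantor_base a j > n for j >= n, so that
   all further digits vanish. *)
Definition Q_additive (R : realType) (a : nat -> nat) (f : nat -> R) : Prop :=
  f 0 = 0 /\
  forall n, f n = \sum_(j < n.+1) f (digit a j n * cantor_base a j)%N.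

Definition digit_mean (R : realType) (a : nat -> nat) (f : nat -> R) (j : nat) : R :=
  (a j)%:R^-1 * \sum_(1 <= d < a j) f (d * cantor_base a j)%N.

Definition digit_sqmean (R : realType) (a : nat -> nat) (f : nat -> R) (j : nat) : R :=
  (a j)%:R^-1 * \sum_(1 <= d < a j) f (d * cantor_base a j)%N ^+ 2.

Definition empirical_df (R : realType) (f : nat -> R) (N : nat) (y : R) : R :=
  N%:R^-1 * #|[pred n : 'I_N | f n <= y]|%:R.

Definition limit_df (R : realType) (f : nat -> R) (y : R) : R :=
  limn (fun N => empirical_df f N y).

Definition sup_norm (R : realType) (g : R -> R) : R :=
  sup [set `|g y| | y in [set: R]].

(* For fixed f there is c > 0 with concentration F (1 / T) >= c / T for T >= 1,
   and in general no c depends only on the bases: for a_j = 2, f(2^j) = 2^j when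
   j < J and f(2^j) = e * 2^-j when j >= J, with e tiny, it is about 2^-J for
   2 <= T <= 2^J. *)
Definition concentration (R : realType) (F : R -> R) (h : R) : R :=
  sup [set F (z + h) - F z | z in [set: R]].

(* max {j >= 0 : q_j <= N < q_(j+1)}; the range is cut at j <= N because
   q_j > j, and for N >= 1 exactly one j satisfies the condition. *)
Definition top_index (a : nat -> nat) (N : nat) : nat :=
  (\max_(j < N.+1 | cantor_base a j <= N < cantor_base a j.+1) j)%N.

(* ceil(log_m (T log T)), possibly negative. Since ln 0 = 0, the value at T = 1,
   where log_m 0 = -oo, is 0. For every T with a nonpositive (or undefined)
   value, Num.sqrt of this integer is 0. *)
Definition cut_length (R : realType) (m : nat) (T : R) : int :=
  Num.ceil (ln (T * ln T) / ln (m%:R : R)).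

(* Main.v *)
(* The proof is a coupling argument. Write n = m q_s + l with l < q_s and
   s = L - h; then f(n) = f(m q_s) + f(l), and for n uniform below N the low part
   l is, up to an error q_s/N <= 1/T, uniform and independent of m. The low part
   of the limit law is the same, so F_N and F differ only through the high
   digits: if U and V denote the two high parts, then
     F_N(y) <= F(y + 1/T) + T (E|U| + E|V|) + 1/T
   by Markov's inequality, and symmetrically below. Second moments bound E|U| and
   E|V| by the mean and square-mean series, the block of means from s to L being
   treated by Cauchy-Schwarz. The term 1/T is absorbed because the concentration
   of F at 1/T is at least c/T; when T < e this also makes the claim trivial.

   The same comparison shows that F_N(y) converges at every y, once the
   concentration of f over n < q_k tends to 0 with the window, uniformly in
   large k. *)

Require Import Defs.
From HB Require Import structures.
From mathcomp Require Import all_boot all_order all_algebra.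
From mathcomp Require Import all_classical all_reals all_analysis.
From mathcomp Require Import ring lra.

Set Implicit Arguments.
Unset Strict Implicit.
Unset Printing Implicit Defensive.

Import Order.TTheory GRing.Theory Num.Theory.
Import numFieldNormedType.Exports.

Local Open Scope classical_set_scope.
Local Open Scope ring_scope.

(** * Averages over initial segments of the integers *)

Definition avg (R : realType) (n : nat) (g : nat -> R) : R :=
  n%:R^-1 * \sum_(0 <= i < n) g i.

Lemma sum_nat_shift (V : nmodType) (s n : nat) (u : nat -> V) :
  \sum_(s <= j < s + n) u j = \sum_(0 <= j < n) u (s + j)%N.
Proof.
by rewrite -{1}[s]add0n big_addn addKn; apply: eq_bigr => j _; rewrite addnC.
Qed.

Lemma sum_nat_mul_split (V : nmodType) (m n : nat) (g : nat -> V) :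
  \sum_(0 <= i < m * n) g i =
  \sum_(0 <= i < m) \sum_(0 <= l < n) g (i * n + l)%N.
Proof.
elim: m => [|m IHm]; first by rewrite mul0n !big_geq.
rewrite mulSnr big_nat_recr //= -IHm (big_cat_nat _ (n := (m * n)%N)) ?leq_addr //=.
by congr (_ + _); apply: sum_nat_shift.
Qed.

Section Avg.
Context {R : realType}.
Implicit Types (g h : nat -> R) (m n : nat) (c : R).

Lemma eq_avg n g h : (forall i, (i < n)%N -> g i = h i) -> avg n g = avg n h.
Proof. by move=> E; congr (_ * _); apply: eq_big_nat => i /andP[_ /E]. Qed.

Lemma le_avg n g h : (forall i, (i < n)%N -> g i <= h i) -> avg n g <= avg n h.
Proof.
move=> E; rewrite ler_wpM2l ?invr_ge0 ?ler0n //.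
by rewrite big_nat [leRHS]big_nat; apply: ler_sum => i /andP[_ /E].
Qed.

Lemma avgD n g h : avg n (fun i => g i + h i) = avg n g + avg n h.
Proof. by rewrite /avg big_split mulrDr. Qed.

Lemma avgZ n c g : avg n (fun i => c * g i) = c * avg n g.
Proof. by rewrite /avg -mulr_sumr mulrCA. Qed.

Lemma avg_cst n c : (0 < n)%N -> avg n (fun=> c) = c.
Proof.
move=> n0; rewrite /avg sumr_const_nat subn0 -[c *+ n]mulr_natl mulKf //.
by rewrite pnatr_eq0 -lt0n.
Qed.

Lemma avg_ge0 n g : (forall i, (i < n)%N -> 0 <= g i) -> 0 <= avg n g.
Proof.
move=> g0; rewrite mulr_ge0 ?invr_ge0 ?ler0n //.
by rewrite big_nat; apply: sumr_ge0 => i /andP[_ /g0].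
Qed.

Lemma avg_le_cst n g c : (0 < n)%N -> (forall i, (i < n)%N -> g i <= c) ->
  avg n g <= c.
Proof. by move=> n0 gc; rewrite -[leRHS](avg_cst c n0); apply: le_avg. Qed.

Lemma avg_mul m n g :
  avg (m * n) g = avg m (fun i => avg n (fun l => g (i * n + l)%N)).
Proof.
by rewrite /avg -mulr_sumr sum_nat_mul_split natrM invfM mulrA.
Qed.

Lemma exchange_avg m n (g : nat -> nat -> R) :
  avg m (fun i => avg n (fun j => g i j)) = avg n (fun j => avg m (fun i => g i j)).
Proof. by rewrite /avg -!mulr_sumr exchange_big /= mulrCA. Qed.

(** The variance of [|g|] is nonnegative. *)
Lemma avg_norm_le_sqrt n g : (0 < n)%N ->
  avg n (fun i => `|g i|) <= Num.sqrt (avg n (fun i => g i ^+ 2)).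
Proof.
move=> n0; set u := avg n _; set v := avg n _.
have u0 : 0 <= u by apply: avg_ge0.
have : 0 <= avg n (fun i => (`|g i| - u) ^+ 2) by apply: avg_ge0 => i _; apply: sqr_ge0.
have -> : avg n (fun i => (`|g i| - u) ^+ 2) =
    avg n (fun i => (g i ^+ 2 + (- 2 * u) * `|g i|) + u ^+ 2).
  by apply: eq_avg => i _; rewrite -[g i ^+ 2]real_normK ?num_real //; ring.
rewrite !avgD avgZ avg_cst // -/u -/v => H.
by rewrite -[leLHS]ger0_norm // -sqrtr_sqr ler_wsqrtr //; nra.
Qed.

(** A longer range only adds nonnegative terms to the sum, and the normalising factors differ by a
    ratio of at most [c]. *)
Lemma avg_le_longer n m c g : (forall i, 0 <= g i) -> (0 < n)%N -> (n <= m)%N ->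
  m%:R <= c * n%:R -> avg n g <= c * avg m g.
Proof.
move=> g0 n0 nm mc; rewrite /avg mulrA.
have n1 : 0 < n%:R :> R by rewrite ltr0n.
have m1 : 0 < m%:R :> R by rewrite ltr0n (leq_trans n0).
apply: ler_pM; rewrite ?invr_ge0 ?ler0n ?sumr_ge0 //.
  by rewrite ler_pdivlMr // ler_pdivrMl // mulrC.
by rewrite [leRHS](big_cat_nat _ (n := n)) //= lerDl sumr_ge0.
Qed.

Lemma avg_truncate n q g : (forall i, 0 <= g i <= 1) -> (0 < q <= n)%N ->
  `|avg n g - avg (n %/ q * q) g| <= q%:R / n%:R.
Proof.
move=> g01 /andP[q0 qn]; have n0 : (0 < n)%N by exact: leq_trans qn.
set m := (n %/ q * q)%N.
have m0 : (0 < m)%N by rewrite muln_gt0 q0 andbT divn_gt0.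
have mn : (m <= n)%N by apply: leq_divM.
have nmq : (n <= m + q)%N.
  by rewrite {1}(divn_eq n q) -/m leq_add2l ltnW // ltn_mod.
have m1 : 0 < m%:R :> R by rewrite ltr0n.
have n1 : 0 < n%:R :> R by rewrite ltr0n.
have nmqR : n%:R <= m%:R + q%:R :> R by rewrite -natrD ler_nat.
set S := \sum_(0 <= i < m) g i.
set U := \sum_(m <= i < n) g i.
have En : avg n g = n%:R^-1 * (S + U) by rewrite /avg (big_cat_nat _ (n := m)).
have S0 : 0 <= S by apply: sumr_ge0 => i _; case/andP: (g01 i).
have U0 : 0 <= U by apply: sumr_ge0 => i _; case/andP: (g01 i).
have Sm : S <= m%:R.
  apply: (@le_trans _ _ (\sum_(0 <= i < m) 1)); last by rewrite sumr_const_nat subn0.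
  by apply: ler_sum => i _; case/andP: (g01 i).
have Um : U <= n%:R - m%:R.
  apply: (@le_trans _ _ (\sum_(m <= i < n) 1)); last first.
    by rewrite sumr_const_nat -natrB.
  by apply: ler_sum => i _; case/andP: (g01 i).
rewrite ler_pdivlMr // -[X in _ * X](ger0_norm (ltW n1)) -normrM En /avg -/S.
(* Both [U] and the product subtracted from it lie between 0 and [n - m], which is at most [q]. *)
have -> : (n%:R^-1 * (S + U) - m%:R^-1 * S) * n%:R =
   U - (n%:R - m%:R) * (S / m%:R).
  by field; rewrite ?gt_eqF.
have : 0 <= S / m%:R <= 1 by rewrite divr_ge0 ?ler0n //= ler_pdivrMr // mul1r.
have : m%:R <= n%:R :> R by rewrite ler_nat.
move: (S / m%:R) => v mnR /andP[v0 v1].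
by rewrite ler_norml; apply/andP; split; nra.
Qed.

End Avg.

(** * Cantor bases and additivity across a cut of the digits *)

Lemma cantor_base_gt0 (a : nat -> nat) (ha : forall n, (2 <= a n)%N) j :
  (0 < cantor_base a j)%N.
Proof. exact: leq_ltn_trans (cantor_base_gt ha j). Qed.

Lemma cantor_baseD (a : nat -> nat) s t :
  cantor_base a (s + t) =
  (cantor_base (fun j => a (s + j)%N) t * cantor_base a s)%N.
Proof.
elim: t => [|t IHt]; first by rewrite addn0 mul1n.
by rewrite addnS /= IHt mulnA.
Qed.

Lemma leq_cantor_base (a : nat -> nat) (ha : forall n, (2 <= a n)%N) s t :
  (s <= t)%N -> (cantor_base a s <= cantor_base a t)%N.
Proof.
by move=> /subnKC <-; rewrite cantor_baseD leq_pmull // cantor_base_gt0.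
Qed.

(** The form in which Q-additivity is used: it mentions no digits and passes to the function of the
    higher digits ([splitting_shift]). *)
Definition splitting (R : realType) (a : nat -> nat) (f : nat -> R) : Prop :=
  forall s m l, (l < cantor_base a s)%N ->
    f (m * cantor_base a s + l)%N = f (m * cantor_base a s)%N + f l.

(** Below position [s] the digits of the sum are those of [l], from [s] on they are those of the
    multiple of q_s, and the complementary digits of each summand vanish. *)
Lemma Q_additive_splitting (R : realType) (a : nat -> nat) (f : nat -> R) :
  (forall n, (2 <= a n)%N) -> Q_additive a f -> splitting a f.
Proof.
move=> ha [f0 fE] s m l ls.
have q0 := cantor_base_gt0 ha.
(* Digits beyond position [n] vanish, so all three expansions can be given the same length. *)
have fK n K : (n <= K)%N ->
    f n = \sum_(0 <= j < K.+1) f (digit a j n * cantor_base a j)%N.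
  move=> nK; rewrite (big_cat_nat _ (n := n.+1)) //= big_mkord -fE.
  rewrite big_nat big1 ?addr0 // => j /andP[nj _].
  by rewrite /digit divn_small ?mod0n // (ltn_trans nj) // cantor_base_gt.
set q := cantor_base a s in ls *.
rewrite (fK _ (m * q + l)%N (leqnn _)) (fK _ _ (leq_addr l _)) (fK _ _ (leq_addl (m * q)%N l)).
rewrite -big_split /=; apply: eq_bigr => j _; have [js|sj] := ltnP j s.
  have [c Ec] : exists c, q = (c * (a j * cantor_base a j))%N.
    exists (cantor_base (fun i => a (j.+1 + i)%N) (s - j.+1)).
    by have := cantor_baseD a j.+1 (s - j.+1); rewrite subnKC.
  have -> : digit a j (m * q)%N = 0%N.
    by rewrite /digit Ec !mulnA mulnK // modnMl.
  rewrite mul0n f0 add0r /digit Ec !mulnA divnMDl //.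
  by rewrite modnMDl.
have E : cantor_base a j = (q * cantor_base (fun i => a (s + i)%N) (j - s))%N.
  by rewrite mulnC -cantor_baseD subnKC.
have -> : digit a j l = 0%N.
  by rewrite /digit divn_small ?mod0n // (leq_trans ls) // leq_cantor_base.
have Em : ((m * q + l) %/ q = m)%N by rewrite divnMDl ?q0 // divn_small ?addn0.
by rewrite mul0n f0 addr0 /digit E !divnMA Em mulnK ?q0.
Qed.

(** * First and second moments over a full block of digits *)

Section Moments.
Context {R : realType} (a : nat -> nat) (f : nat -> R).
Hypotheses (ha : forall n, (2 <= a n)%N) (hf : splitting a f).

Lemma splitting0 : f 0%N = 0.
Proof.
have := @hf 0%N 0%N 0%N isT.
by rewrite mul0n addn0 => H; lra.
Qed.

Let a0 k : (0 < a k)%N. Proof. exact: leq_trans (ha k). Qed.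

Lemma digit_meanE k :
  digit_mean a f k = avg (a k) (fun d => f (d * cantor_base a k)%N).
Proof. by rewrite /avg big_ltn // mul0n splitting0 add0r. Qed.

Lemma digit_sqmeanE k :
  digit_sqmean a f k = avg (a k) (fun d => f (d * cantor_base a k)%N ^+ 2).
Proof. by rewrite /avg big_ltn // mul0n splitting0 expr0n add0r. Qed.

Lemma avg_cantor_base k :
  avg (cantor_base a k) f = \sum_(0 <= j < k) digit_mean a f j.
Proof.
elim: k => [|k IHk]; first by rewrite big_geq // /avg big_nat1 splitting0 mulr0.
rewrite big_nat_recr //= -IHk avg_mul digit_meanE addrC.
rewrite -[X in _ = _ + X](avg_cst _ (a0 k)) -avgD; apply: eq_avg => d _.
rewrite -[X in _ = X + _](avg_cst _ (cantor_base_gt0 ha k)) -avgD.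
by apply: eq_avg => l /hf.
Qed.

(** The digits of a uniform n < q_k are independent, so the second moment is the squared mean plus
    the sum of the variances, and each variance is at most the corresponding [digit_sqmean]. *)
Lemma avg_sqr_cantor_base k :
  avg (cantor_base a k) (fun n => f n ^+ 2) <=
  (\sum_(0 <= j < k) digit_mean a f j) ^+ 2 + \sum_(0 <= j < k) digit_sqmean a f j.
Proof.
elim: k => [|k IHk].
  by rewrite !big_geq // /avg big_nat1 splitting0 expr0n mulr0 addr0.
rewrite !big_nat_recr //= avg_mul /= digit_sqmeanE digit_meanE.
set q := cantor_base a k in IHk *; have q0 := cantor_base_gt0 ha k : (0 < q)%N.
set M := \sum_(0 <= j < k) _ in IHk *; set S := \sum_(0 <= j < k) _ in IHk *.
set m := avg (a k) (fun d => f _); set s := avg (a k) (fun d => _ ^+ 2).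
have -> : avg (a k) (fun d => avg q (fun l => f (d * q + l)%N ^+ 2)) =
    s + (2 * M * m + avg q (fun n => f n ^+ 2)).
  rewrite -avgZ -[X in _ + (_ + X)](avg_cst _ (a0 k)) -!avgD.
  apply: eq_avg => d _.
  have -> : avg q (fun l => f (d * q + l)%N ^+ 2) =
      avg q (fun l => (f (d * q)%N ^+ 2 + 2 * f (d * q)%N * f l) + f l ^+ 2).
    by apply: eq_avg => l lq; rewrite hf //; ring.
  rewrite !avgD avgZ avg_cst // avg_cantor_base -/M; ring.
have : 0 <= m ^+ 2 by apply: sqr_ge0.
nra.
Qed.

Lemma avg_norm_cantor_base k :
  avg (cantor_base a k) (fun n => `|f n|) <=
  `|\sum_(0 <= j < k) digit_mean a f j| +
  Num.sqrt (\sum_(0 <= j < k) digit_sqmean a f j).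
Proof.
apply: le_trans (avg_norm_le_sqrt _ (cantor_base_gt0 ha k)) _.
have S0 : 0 <= \sum_(0 <= j < k) digit_sqmean a f j.
  apply: sumr_ge0 => j _; rewrite digit_sqmeanE.
  by apply: avg_ge0 => d _; apply: sqr_ge0.
apply: (@le_trans _ _ (Num.sqrt ((`|\sum_(0 <= j < k) digit_mean a f j| +
    Num.sqrt (\sum_(0 <= j < k) digit_sqmean a f j)) ^+ 2))).
  rewrite ler_wsqrtr // (le_trans (avg_sqr_cantor_base k)) //.
  rewrite sqrrD real_normK ?num_real // sqr_sqrtr // lerD2r lerDl.
  by rewrite mulrn_wge0 // mulr_ge0 ?sqrtr_ge0.
by rewrite sqrtr_sqr ger0_norm // addr_ge0 ?sqrtr_ge0.
Qed.

End Moments.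

(** * Comparison of distribution functions by coupling *)

(** All terms are averaged over triples of two independent high parts and one shared low part [l].
    If the left indicator is 1 and the right one 0, the high contributions [u] and [v] differ by
    more than [e], so the last term is at least 1. *)
Lemma avg_df_compare (R : realType) (f : nat -> R) (q m n : nat) (e y : R) :
  (forall i l, (l < q)%N -> f (i * q + l)%N = f (i * q)%N + f l) ->
  (0 < q)%N -> (0 < m)%N -> (0 < n)%N -> 0 < e ->
  avg (m * q) (fun i => (f i <= y)%R%:R) <=
  avg (n * q) (fun i => (f i <= y + e)%R%:R) +
  e^-1 * (avg m (fun i => `|f (i * q)%N|) + avg n (fun i => `|f (i * q)%N|)).
Proof.
move=> hf q0 m0 n0 e0; rewrite !avg_mul /=.
set P' := fun i => avg q (fun l => (f (i * q + l)%N <= y + e)%R%:R).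
set U := avg n (fun i => `|f _|).
have -> : avg n (fun i => P' i) + e^-1 * (avg m (fun i => `|f (i * q)%N|) + U) =
    avg m (fun i => (avg n (fun i => P' i) + e^-1 * U) + e^-1 * `|f (i * q)%N|).
  by rewrite avgD avg_cst // [X in _ = _ + X]avgZ; ring.
apply: le_avg => i _.
rewrite -[leLHS](avg_cst _ n0) -[X in _ <= _ + X](avg_cst _ n0) -avgZ -!avgD.
apply: le_avg => j _; rewrite /P'.
rewrite -[X in _ <= _ + X + _](avg_cst _ q0) -[X in _ <= _ + X](avg_cst _ q0) -!avgD.
apply: le_avg => l lq; rewrite !hf // -addrA -mulrDr.
set u := f (i * q)%N; set v := f (j * q)%N.
have V0 : 0 <= e^-1 * (`|v| + `|u|) by rewrite mulr_ge0 ?addr_ge0 // invr_ge0 ltW.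
case: (leP (u + f l)) => [H1|_]; last by rewrite addr_ge0.
have [H2|H2] := leP (v + f l) (y + e); first by rewrite lerDl.
rewrite add0r ler_pdivlMl // mulr1.
by have := ler_norm v; have := ler_norm (- u); rewrite normrN; lra.
Qed.

(** * Concentration on short intervals *)

Lemma interval_translate (R : realType) (x v z e : R) :
  (z < x + v <= z + e) = (z - v < x <= z - v + e).
Proof. by apply/andP/andP => -[]; split; lra. Qed.

(** The windows translated by [v d1] and [v d2] are at least [x] apart and have length at most
    [x / 3], so one of them avoids the part of the line where [|u i| < x / 3]. By Markov's
    inequality that digit costs at most [delta]; each of the others costs at most [p]. *)
Lemma avg_two_point (R : realType) (n m d1 d2 : nat) (u v : nat -> R)
    (x e p delta : R) :
  (d1 < n)%N -> (d2 < n)%N -> (0 < m)%N -> v d2 + x <= v d1 ->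
  0 < x -> e <= x / 3 -> 0 <= delta ->
  avg m (fun i => `|u i|) <= delta * (x / 3) ->
  (forall z, avg m (fun i => (z < u i <= z + e)%R%:R) <= p) ->
  forall z, avg n (fun d => avg m (fun i => (z < u i + v d <= z + e)%R%:R)) <=
    (1 - n%:R^-1) * p + delta.
Proof.
move=> d1n d2n m0 vx x0 ex delta0 udelta up z.
set g := fun d => avg m _.
have n0 : (0 < n)%N by exact: leq_ltn_trans d1n.
have gp d : g d <= p.
  apply: le_trans (up (z - v d)); apply: le_avg => i _.
  by rewrite interval_translate.
have x3 : 0 < x / 3 by rewrite divr_gt0.
have gdelta d : (forall i, z < u i + v d <= z + e -> x / 3 <= `|u i|) ->
    g d <= delta.
  move=> H; rewrite -(ler_pM2r x3); apply: le_trans udelta.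
  rewrite mulrC -avgZ; apply: le_avg => i _.
  by case: (boolP (z < _ <= _)) => [/H|_]; rewrite ?mulr1 ?mulr0.
have [d0 d0n gd0] : exists2 d, (d < n)%N & g d <= delta.
  have [H|H] := leP (x / 3) (z - v d2).
    exists d2 => //; apply: gdelta => i /andP[H1 H2].
    by apply: le_trans (ler_norm _); lra.
  exists d1 => //; apply: gdelta => i /andP[H1 H2].
  by rewrite -normrN; apply: le_trans (ler_norm _); lra.
(* The majorant equals [delta] at the good digit [d0] and [p] elsewhere. *)
apply: (@le_trans _ _ (avg n (fun i => p + (delta - p) * (i == d0)%:R))).
  apply: le_avg => i _; case: eqP => [->|_]; first by rewrite mulr1 addrC subrK.
  by rewrite mulr0 addr0.
have d0E : \sum_(0 <= i < n) ((i == d0)%:R : R) = 1.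
  rewrite big_mkord (bigD1 (Ordinal d0n)) //= eqxx big1 ?addr0 // => i.
  by rewrite -val_eqE /= => /negbTE ->.
rewrite avgD avg_cst // avgZ /avg d0E mulr1.
have : n%:R^-1 <= 1 :> R by rewrite invf_le1 ?ler1n ?ltr0n.
have : 0 <= n%:R^-1 :> R by rewrite invr_ge0 ler0n.
nra.
Qed.

(** Write the integer as i q_t + w q_(j+1) + d q_j + r. For fixed [w] and [r] their contribution
    only translates the window, and [avg_two_point] applies to the average over [i] and [d]. *)
Lemma avg_interval_step (R : realType) (a : nat -> nat) (f : nat -> R)
    (j t n d1 d2 : nat) (x e p delta : R) :
  (forall n, (2 <= a n)%N) -> splitting a f -> (j < t)%N -> (0 < n)%N ->
  (d1 < a j)%N -> (d2 < a j)%N ->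
  f (d2 * cantor_base a j)%N + x <= f (d1 * cantor_base a j)%N ->
  0 < x -> e <= x / 3 -> 0 <= delta ->
  avg n (fun m => `|f (m * cantor_base a t)%N|) <= delta * (x / 3) ->
  (forall z, avg n (fun m => (z < f (m * cantor_base a t)%N <= z + e)%R%:R) <= p) ->
  forall z, avg (n * cantor_base a t) (fun i => (z < f i <= z + e)%R%:R) <=
    (1 - (a j)%:R^-1) * p + delta.
Proof.
move=> ha hf jt n0 d1a d2a vx x0 ex delta0 udelta up z.
set c := cantor_base (fun i => a (j.+1 + i)%N) (t - j.+1).
have Et : cantor_base a t = (c * cantor_base a j.+1)%N.
  by rewrite -cantor_baseD subnKC.
have c0 : (0 < c)%N by apply: cantor_base_gt0.
rewrite avg_mul exchange_avg {1}Et avg_mul.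
apply: avg_le_cst => // w wc; rewrite /= avg_mul exchange_avg.
apply: avg_le_cst => [|r rj]; first exact: cantor_base_gt0.
set y := f (w * cantor_base a j.+1)%N + f r.
have key := avg_two_point (v := fun d => f (d * cantor_base a j)%N) d1a d2a n0 vx x0 ex delta0 udelta up (z - y).
apply: le_trans key; apply: le_avg => d da; apply: le_avg => i _.
have lt1 : (d * cantor_base a j + r < cantor_base a j.+1)%N.
  apply: (@leq_trans (d.+1 * cantor_base a j)); first by rewrite mulSnr ltn_add2l.
  by rewrite /= leq_mul2r da orbT.
have lt2 : (w * (a j * cantor_base a j) + (d * cantor_base a j + r) < cantor_base a t)%N.
  rewrite Et; apply: (@leq_trans (w.+1 * cantor_base a j.+1)).
    by rewrite mulSnr ltn_add2l.
  by rewrite leq_mul2r wc orbT.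
rewrite hf // -[(a j * _)%N]/(cantor_base a j.+1) hf // hf //.
set X := f (i * _)%N; set Y := f (d * _)%N.
have -> : X + (f (w * cantor_base a j.+1)%N + (Y + f r)) = X + Y + y by rewrite /y; ring.
by rewrite (interval_translate (X + Y)).
Qed.

Lemma splitting_shift (R : realType) (a : nat -> nat) (f : nat -> R) s :
  (forall n, (2 <= a n)%N) -> splitting a f ->
  splitting (fun j => a (s + j)%N) (fun m => f (m * cantor_base a s)%N).
Proof.
move=> ha hf t m l lt; rewrite mulnDl -mulnA -cantor_baseD hf //.
by rewrite cantor_baseD ltn_mul2r lt cantor_base_gt0.
Qed.

Lemma avg_norm_block (R : realType) (a : nat -> nat) (f : nat -> R) s t :
  (forall n, (2 <= a n)%N) -> splitting a f ->
  avg (cantor_base (fun j => a (s + j)%N) t)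
      (fun m => `|f (m * cantor_base a s)%N|) <=
  `|\sum_(s <= j < s + t) digit_mean a f j| +
  Num.sqrt (\sum_(s <= j < s + t) digit_sqmean a f j).
Proof.
move=> ha hf.
rewrite !(sum_nat_shift s).
have := avg_norm_cantor_base (fun n => ha (s + n)%N) (splitting_shift (s := s) ha hf) t.
congr (_ <= `|_| + Num.sqrt _); apply: eq_bigr => j _;
  rewrite /digit_mean /digit_sqmean; congr (_ * _); apply: eq_bigr => d _;
  by rewrite cantor_baseD mulnA.
Qed.

(* The class is closed under dropping the low digits (tame_shift); the third
   clause says that the digits from s on contribute little to f, in L^1 norm. *)
Definition tame (R : realType) (A : nat) (a : nat -> nat) (f : nat -> R) : Prop :=
  [/\ forall n, (2 <= a n <= A)%N,
      splitting a f,
      forall eta : R, 0 < eta -> exists s0, forall s t, (s0 <= s)%N ->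
        avg (cantor_base (fun j => a (s + j)%N) t)
            (fun m => `|f (m * cantor_base a s)%N|) <= eta
    & forall s, exists j d,
        [/\ (s <= j)%N, (d < a j)%N & f (d * cantor_base a j)%N != 0]].

Lemma tame_shift (R : realType) A (a : nat -> nat) (f : nat -> R) r :
  tame A a f ->
  tame A (fun j => a (r + j)%N) (fun m => f (m * cantor_base a r)%N).
Proof.
move=> [ha hf tail nz]; split=> //.
- by apply: splitting_shift => // n; case/andP: (ha n).
- move=> eta /tail[s0 Hs0]; exists s0 => s t ss0.
  have := Hs0 (r + s)%N t (leq_trans ss0 (leq_addl _ _)).
  under [X in cantor_base X]eq_fun do rewrite -addnA.
  by congr (_ <= _); apply: eq_avg => m _; rewrite cantor_baseD mulnA.
- move=> s; have [j [d [sj da fd]]] := nz (r + s)%N.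
  have rj : (r <= j)%N by apply: leq_trans sj; apply: leq_addr.
  exists (j - r)%N, d; rewrite subnKC // -mulnA -cantor_baseD subnKC //.
  by split=> //; rewrite -(leq_add2l r) subnKC.
Qed.

(** One [p] has to serve all tame pairs with the same [A], because the improvement step applies the
    bound to the function of the higher digits; only [e] and [k0] depend on the pair. *)
Definition interval_bound (R : realType) (A : nat) (p : R) : Prop :=
  forall a f, tame A a f -> exists2 e : R, 0 < e & exists k0, forall k, (k0 <= k)%N ->
    forall z, avg (cantor_base a k) (fun n => (z < f n <= z + e)%R%:R) <= p.

(* Take a digit j with a nonzero value v, and t so large that the contribution Y
   of the digits from t on is typically much smaller than |v|. Conditioning on
   all digits other than j and those from t on, a window of length at most |v|/3
   cannot catch Y with good probability both when digit j contributes 0 and when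
   it contributes v, so the bound p for Y improves by the factor 1 - 1/a_j. *)
Lemma interval_bound_improve (R : realType) A (p delta : R) :
  0 <= p -> 0 < delta -> interval_bound A p ->
  interval_bound A ((1 - A%:R^-1) * p + delta).
Proof.
move=> p0 delta0 IH a f tf; have [hA hf tail nz] := tf.
have ha n : (2 <= a n)%N by case/andP: (hA n).
have [j [d [_ da fd]]] := nz 0%N.
set x := `|f (d * cantor_base a j)%N|; have x0 : 0 < x by rewrite normr_gt0.
have x3 : 0 < x / 3 by rewrite divr_gt0.
have [s0 Hs0] := tail _ (mulr_gt0 delta0 x3).
set t := maxn s0 j.+1.
have [e e0 [k0 He]] := IH _ _ (tame_shift t tf).
have a0 : (0 < a j)%N by apply: leq_trans (ha j).
exists (Num.min e (x / 3)); first by rewrite lt_min e0 x3.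
exists (t + k0)%N => k kk0 z.
have tk : (t <= k)%N by apply: leq_trans kk0; apply: leq_addr.
have -> : cantor_base a k =
    (cantor_base (fun i => a (t + i)%N) (k - t) * cantor_base a t)%N.
  by rewrite -cantor_baseD subnKC.
set B := cantor_base _ (k - t).
have B0 : (0 < B)%N by apply: cantor_base_gt0.
have step d1 d2 : (d1 < a j)%N -> (d2 < a j)%N ->
    f (d2 * cantor_base a j)%N + x <= f (d1 * cantor_base a j)%N ->
    avg (B * cantor_base a t)
      (fun n => (z < f n <= z + Num.min e (x / 3))%R%:R) <=
    (1 - (a j)%:R^-1) * p + delta.
  move=> d1a d2a vx; apply: avg_interval_step d1a d2a vx x0 _ _ _ _ z => //.
  - by rewrite leq_max leqnn orbT.
  - by rewrite ge_min lexx orbT.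
  - exact: ltW.
  - by apply: Hs0; rewrite leq_max leqnn.
  move=> w; apply: le_trans (He (k - t)%N _ w); last first.
    by rewrite -(leq_add2l t) subnKC.
  apply: le_avg => i _; rewrite ler_nat.
  case: andP => // -[H1 H2]; rewrite H1 /= (le_trans H2) // lerD2l.
  by rewrite ge_min lexx.
apply: (@le_trans _ _ ((1 - (a j)%:R^-1) * p + delta)).
  (* The sign decides which of the digits 0 and [d] contributes more. *)
  have [H|H] := leP 0 (f (d * cantor_base a j)%N).
    apply: (step d 0%N) => //.
    by rewrite mul0n (splitting0 hf) add0r /x ger0_norm.
  apply: (step 0%N d) => //.
  by rewrite mul0n (splitting0 hf) /x ltr0_norm // subrr.
rewrite lerD2r ler_wpM2r // lerD2l lerN2 lef_pV2 ?posrE ?ltr0n ?ler_nat //.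
  by case/andP: (hA j).
by apply: leq_trans a0 _; case/andP: (hA j).
Qed.

(** Start from the trivial bound 1 and improve repeatedly. With [delta] equal to r^n/(2A), each step
    multiplies the bound by r = 1 - 1/(2A) < 1. *)
Lemma interval_bound_small (R : realType) A (p : R) :
  (2 <= A)%N -> 0 < p -> interval_bound A p.
Proof.
move=> A2 p0; have A0 : 0 < A%:R :> R by rewrite ltr0n (leq_trans _ A2).
set r : R := 1 - (2 * A%:R)^-1.
have A1 : 0 < (2 * A%:R)^-1 :> R by rewrite invr_gt0 mulr_gt0.
have A3 : (2 * A%:R)^-1 < 1 :> R.
  by rewrite invf_lt1 ?mulr_gt0 // -natrM ltr1n; case: (A) A2 => [|[]].
have r0 : 0 < r by rewrite subr_gt0.
have bd n : @interval_bound R A (r ^+ n).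
  elim: n => [|n IHn].
    move=> a f [hA _ _ _]; exists 1 => //; exists 0%N => k _ z.
    apply: avg_le_cst; last by move=> i _; case: (_ && _).
    by apply: cantor_base_gt0 => n; case/andP: (hA n).
  have := interval_bound_improve (exprn_ge0 n (ltW r0))
    (mulr_gt0 A1 (exprn_gt0 n r0)) IHn.
  congr (interval_bound _ _); rewrite exprS /r; field.
  by rewrite gt_eqF.
have rlt1 : `|r| < 1 by rewrite ger0_norm ?ltW // /r; lra.
have [n _ rn] : exists2 n, True & r ^+ n <= p.
  have /cvgrPdist_lt/(_ p p0)[n _ H] := cvg_expr rlt1.
  exists n => //; have := H n (leqnn _).
  by rewrite /= sub0r normrN => /ltW; apply: le_trans; apply: ler_norm.
move=> a f /(bd n)[e e0 [k0 H]]; exists e => //; exists k0 => k kk0 z.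
exact: le_trans (H k kk0 z) rn.
Qed.

(** * Empirical distribution functions and the position of N among the q_j *)

Lemma empirical_dfE (R : realType) (f : nat -> R) N y :
  empirical_df f N y = avg N (fun n => (f n <= y)%R%:R).
Proof.
rewrite /empirical_df /avg -sum1_card natr_sum big_mkord [in LHS]big_mkcond.
by congr (_ * _); apply: eq_bigr => i _; rewrite inE; case: (_ <= _).
Qed.

Lemma top_indexP (a : nat -> nat) N : (forall n, (2 <= a n)%N) -> (1 <= N)%N ->
  (cantor_base a (top_index a N) <= N < cantor_base a (top_index a N).+1)%N.
Proof.
move=> ha N1; have ex : exists k, (N < cantor_base a k)%N.
  by exists N; apply: cantor_base_gt.
case: (ex_minnP ex) => -[|j] jN jmin; first by move: jN; rewrite /= ltnNge N1.
have jq : (cantor_base a j <= N)%N.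
  by rewrite leqNgt; apply/negP => /jmin; rewrite ltnn.
have jlt : (j < N.+1)%N.
  by rewrite ltnS ltnW // (leq_trans (cantor_base_gt ha j)).
(* A maximum over a nonempty index set is attained; the predecessor [j] of the least k with N < q_k
   shows that the set is nonempty. *)
have [|i iP iE] := @eq_bigmax_cond 'I_N.+1
  [pred i : 'I_N.+1 | cantor_base a i <= N < cantor_base a i.+1]%N (fun i => i).
  by apply/card_gt0P; exists (Ordinal jlt); rewrite inE jq.
by rewrite /top_index iE; move: iP; rewrite inE.
Qed.

(* Under a uniform n < N the digits below s are uniform and independent of the
   higher ones, up to the remainder of N modulo q_s; the law of the digits of n
   from s to L is dominated by A times the uniform one. *)
Lemma df_compare (R : realType) A (a : nat -> nat) (f : nat -> R) (N s L k : nat)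
    (e : R) (V := fun t => avg (cantor_base (fun j => a (s + j)%N) t)
                             (fun m => `|f (m * cantor_base a s)%N|))
    (D := e^-1 * (A%:R * V (L.+1 - s)%N + V (k - s)%N)
          + (cantor_base a s)%:R / N%:R) :
  (forall n, (2 <= a n <= A)%N) -> splitting a f -> (s <= L)%N -> (s <= k)%N ->
  (cantor_base a L <= N < cantor_base a L.+1)%N -> 0 < e ->
  (forall y, avg N (fun n => (f n <= y)%R%:R) <=
     avg (cantor_base a k) (fun n => (f n <= y + e)%R%:R) + D) /\
  (forall y, avg (cantor_base a k) (fun n => (f n <= y)%R%:R) <=
     avg N (fun n => (f n <= y + e)%R%:R) + D).
Proof.
move=> hA hf sL sk /andP[LN NL] e0.
have ha n : (2 <= a n)%N by case/andP: (hA n).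
set q := cantor_base a s in V D *.
have q0 : (0 < q)%N := cantor_base_gt0 ha s.
have qN : (q <= N)%N by apply: leq_trans LN; apply: leq_cantor_base.
set m := (N %/ q)%N.
have m0 : (0 < m)%N by rewrite divn_gt0.
set cb := cantor_base (fun j => a (s + j)%N) in V D *.
have cbE t : (s <= t)%N -> cantor_base a t = (cb (t - s) * q)%N.
  by move=> st; rewrite -cantor_baseD subnKC.
have cb0 t : (0 < cb t)%N by apply: cantor_base_gt0.
have Lm : (cb (L - s) <= m)%N.
  by rewrite -(mulnK (cb (L - s)%N) q0) -cbE // leq_div2r.
have mL : (m <= cb (L.+1 - s))%N.
  rewrite -(leq_pmul2r q0) -cbE ?leqW // (leq_trans (leq_divM _ _)) //.
  exact: ltnW.
(* [m] lies between the sizes of the blocks of digits from [s] to L - 1 and from [s] to L, whose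
   ratio is a_L, at most [A]. *)
have Vm : avg m (fun i => `|f (i * q)%N|) <= A%:R * V (L.+1 - s)%N.
  apply: avg_le_longer => //; rewrite -natrM ler_nat subSn // /cb /= subnKC //.
  by apply: leq_mul => //; case/andP: (hA L).
have trunc y : `|avg N (fun n => (f n <= y)%R%:R) -
    avg (m * q) (fun n => (f n <= y)%R%:R)| <= q%:R / N%:R :> R.
  by apply: avg_truncate; rewrite ?q0 ?qN // => i; rewrite ler0n lern1 leq_b1.
have ei : 0 < e^-1 by rewrite invr_gt0.
have Vk0 : e^-1 * avg m (fun i => `|f (i * q)%N|) <= e^-1 * (A%:R * V (L.+1 - s)%N).
  by rewrite ler_pM2l.
split=> y.
  have := avg_df_compare y (@hf s) q0 m0 (cb0 (k - s)%N) e0.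
  rewrite -cbE // -/q -/(V _).
  have /ler_normlP[] := trunc y; rewrite /D; lra.
have := avg_df_compare y (@hf s) q0 (cb0 (k - s)%N) m0 e0.
rewrite -cbE // -/q -/(V _).
have /ler_normlP[] := trunc (y + e); rewrite /D; lra.
Qed.

Lemma avg_df_diff (R : realType) (f : nat -> R) n z y : z <= y ->
  avg n (fun i => (f i <= y)%R%:R) =
  avg n (fun i => (f i <= z)%R%:R) + avg n (fun i => (z < f i <= y)%R%:R) :> R.
Proof.
move=> zy; rewrite -avgD; apply: eq_avg => i _.
by have [H|H] := leP (f i) z; rewrite /= ?(le_trans H zy) ?addr0 ?add0r.
Qed.

(** * The limit distribution function and its concentration *)

Section Limit.
Context {R : realType} (A : nat) (a : nat -> nat) (f : nat -> R).
Hypothesis tf : tame A a f.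

Let hA n : (2 <= a n <= A)%N. Proof. by case: tf. Qed.
Let ha n : (2 <= a n)%N. Proof. by case/andP: (hA n). Qed.
Let hf : splitting a f. Proof. by case: tf. Qed.
Let A2 : (2 <= A)%N. Proof. by case/andP: (hA 0) => /leq_trans; apply. Qed.

(** [k0] may depend on [N]: two large values of [N] are then compared through a common [k], which
    gives the Cauchy property. The window [e] is fixed first, then the cut [s], then [N]. *)
Lemma df_near_cantor_base (eta : R) : 0 < eta ->
  exists N0, forall N, (N0 <= N)%N -> exists k0, forall k, (k0 <= k)%N ->
    forall y, `|empirical_df f N y - empirical_df f (cantor_base a k) y| <= eta.
Proof.
move=> eta0; have eta4 : 0 < eta / 4 by rewrite divr_gt0.
have [e e0 [k1 He]] := interval_bound_small A2 eta4 tf.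
have [_ _ tail _] := tf.
have A0 : 0 < A%:R :> R by rewrite ltr0n (leq_trans _ A2).
have A10 : 0 < A%:R + 1 :> R by rewrite addr_gt0.
(* This makes the Markov term, [e^-1] times [A] tail averages plus one more, at most [eta / 4]. *)
have [s Hs] := tail (e * (eta / 4) / (A%:R + 1)) (divr_gt0 (mulr_gt0 e0 eta4) A10).
set q := cantor_base a s; have q0 : (0 < q)%N := cantor_base_gt0 ha s.
(* The first bound gives s <= L, the second q_s/N <= [eta / 4]. *)
exists (maxn q (Num.truncn (q%:R / (eta / 4))).+1) => N.
rewrite geq_max => /andP[qN etaN].
have N0 : (0 < N)%N by exact: leq_trans qN.
set L := top_index a N; have LN := top_indexP ha N0.
have sL : (s <= L)%N.
  rewrite leqNgt; apply/negP => Ls; have := leq_cantor_base ha Ls.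
  by case/andP: LN => _ LN; rewrite leqNgt (leq_ltn_trans qN LN).
exists (maxn k1 s) => k; rewrite geq_max => /andP[k1k sk] y.
rewrite !empirical_dfE.
have [H1 H2] := df_compare hA hf sL sk LN e0.
have qNR : q%:R / N%:R <= eta / 4.
  rewrite ler_pdivrMr ?ltr0n // mulrC -ler_pdivrMr //.
  apply: ltW; apply: lt_le_trans (truncnS_gt _) _; by rewrite ler_nat.
have V1 := Hs s (L.+1 - s)%N (leqnn s); have V2 := Hs s (k - s)%N (leqnn s).
set V := avg _ _ in V1; set W := avg _ _ in V2.
rewrite -/V -/W -/q in H1 H2.
have D2 : e^-1 * (A%:R * V + W) <= eta / 4.
  rewrite ler_pdivrMl //.
  move: V1 V2; rewrite !ler_pdivlMr // => V1 V2.
  nra.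
have := H1 y; have := H2 (y - e); rewrite subrK.
have yl : y - e <= y by rewrite lerBlDr lerDl ltW.
have yr : y <= y + e by rewrite lerDl ltW.
have := avg_df_diff f (cantor_base a k) yl; have := avg_df_diff f (cantor_base a k) yr.
have := He k k1k (y - e); have := He k k1k y; rewrite (subrK e).
by rewrite ler_norml => B1 B2 C1 C2 E1 E2; apply/andP; split; lra.
Qed.

Lemma cvg_empirical_df y : empirical_df f N y @[N --> \oo] --> limit_df f y.
Proof.
suff : cvgn (fun N => empirical_df f N y) by [].
apply: cauchy_cvg; apply: cauchy_exP => e e0.
have e3 : 0 < e / 3 by rewrite divr_gt0.
have [N0 H] := df_near_cantor_base e3.
exists (empirical_df f N0 y); exists N0 => // N /= N0N.
have [k1 H1] := H _ (leqnn N0); have [k2 H2] := H _ N0N.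
have := H1 _ (leq_maxl k1 k2) y; have := H2 _ (leq_maxr k1 k2) y.
rewrite /ball /= => /ler_normlP[? ?] /ler_normlP[? ?].
by apply/ltr_normlP; split; lra.
Qed.

(** Since q_k > k, this follows the convergent F_N along indices tending to infinity. *)
Lemma cvg_df_cantor_base y :
  avg (cantor_base a k) (fun n => (f n <= y)%R%:R) @[k --> \oo] --> limit_df f y.
Proof.
under eq_fun do rewrite -empirical_dfE.
apply: (cvg_comp (cantor_base a) (fun N => empirical_df f N y)); last exact: cvg_empirical_df.
move=> P [n _ Pn]; exists n => // k /= nk; apply: Pn => /=.
by apply: leq_trans nk _; apply: ltnW; apply: cantor_base_gt.
Qed.

Lemma empirical_df_ge0 N y : 0 <= empirical_df f N y.
Proof. by rewrite empirical_dfE; apply: avg_ge0. Qed.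

Lemma empirical_df_le1 N y : empirical_df f N y <= 1.
Proof.
rewrite empirical_dfE; case: N => [|N]; first by rewrite /avg big_geq // mulr0.
by apply: avg_le_cst => // i _; rewrite lern1 leq_b1.
Qed.

Lemma limit_df_ge0 y : 0 <= limit_df f y.
Proof.
by apply: (cvgr_to_ge (@cvg_empirical_df y)); apply: nearW => N; apply: empirical_df_ge0.
Qed.

Lemma limit_df_le1 y : limit_df f y <= 1.
Proof.
by apply: (cvgr_to_le (@cvg_empirical_df y)); apply: nearW => N; apply: empirical_df_le1.
Qed.

Lemma limit_df_le z y : z <= y -> limit_df f z <= limit_df f y.
Proof.
move=> zy; apply: (ler_cvg_to (@cvg_empirical_df z) (@cvg_empirical_df y)).
apply: nearW => N; rewrite !empirical_dfE (avg_df_diff _ _ zy) lerDl.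
exact: avg_ge0.
Qed.

(** As F takes values in [0, 1], the supremum is over a bounded set and is a true upper bound. *)
Lemma limit_df_concentration z h :
  limit_df f (z + h) - limit_df f z <= concentration (limit_df f) h.
Proof.
apply: ub_le_sup; last by exists z.
exists 1 => _ [w _ <-].
by have := limit_df_ge0 w; have := limit_df_le1 (w + h); lra.
Qed.

(** By Markov's inequality F has mass at least 1/2 on a fixed interval (-b, b]. Covering it by O(T)
    windows of length 1/T forces one of them to carry mass of order 1/T. *)
Lemma concentration_lower :
  exists2 c : R, 0 < c & forall T, 1 <= T -> c <= T * concentration (limit_df f) (1 / T).
Proof.
have [_ _ tail _] := tf; have [s Hs] := tail 1 ltr01.
(* The digits from [s] on contribute at most 1 to the mean of [|f|], so [M] bounds this mean over
   every n < q_k with k >= s. *)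
set M := 1 + avg (cantor_base a s) (fun n => `|f n|).
have M1 : 1 <= M by rewrite lerDl avg_ge0.
have fM k : (s <= k)%N -> avg (cantor_base a k) (fun n => `|f n|) <= M.
  move=> sk; rewrite -(subnKC sk) cantor_baseD avg_mul /=.
  apply: (@le_trans _ _ (avg (cantor_base (fun j => a (s + j)%N) (k - s)) (fun m =>
      `|f (m * cantor_base a s)%N| + avg (cantor_base a s) (fun n => `|f n|)))).
    apply: le_avg => m _; have q0 := cantor_base_gt0 ha s.
    rewrite -[X in _ <= X + _](avg_cst _ q0) -avgD; apply: le_avg => l ls.
    by rewrite hf // ler_normD.
  by rewrite avgD lerD // ?Hs // avg_cst // cantor_base_gt0.
set b := 2 * M.
have b0 : 0 < b by rewrite /b; lra.
have half : 2^-1 <= limit_df f b - limit_df f (- b).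
  have cv : avg (cantor_base a k) (fun n => (f n <= b)%R%:R) -
      avg (cantor_base a k) (fun n => (f n <= - b)%R%:R) @[k --> \oo] -->
      limit_df f b - limit_df f (- b).
    by apply: cvgB; apply: cvg_df_cantor_base.
  apply: (cvgr_to_ge cv); exists s => // k /= sk.
  have q0 := cantor_base_gt0 ha k.
  have bb : - b <= b by lra.
  rewrite (avg_df_diff f (cantor_base a k) bb) addrAC subrr add0r.
  (* The indicator of (-b, b] is at least 1 - |f|/b, whose mean is at least 1/2 because b = 2M. *)
  apply: (@le_trans _ _ (avg (cantor_base a k) (fun n => 1 + - b^-1 * `|f n|))).
    rewrite avgD avgZ avg_cst // mulNr lerBrDr.
    have : b^-1 * avg (cantor_base a k) (fun n => `|f n|) <= 2^-1.
      by rewrite ler_pdivrMl //; have := fM k sk; rewrite /b; lra.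
    by lra.
  apply: le_avg => n _; rewrite mulNr.
  have bf : 0 <= b^-1 * `|f n| by rewrite mulr_ge0 // invr_ge0 ltW.
  case: (boolP (_ < _ <= _)) => [_|H]; first by rewrite lerBlDr lerDl.
  rewrite /= subr_le0 ler_pdivlMl // mulr1.
  move: H; rewrite negb_and -leNgt -ltNge => /orP[H|H].
    by rewrite -normrN; apply: le_trans (ler_norm _); lra.
  by apply: le_trans (ltW H) (ler_norm _).
exists (2^-1 / (2 * b + 1)); first by rewrite divr_gt0 //; lra.
move=> T T1; set Q := concentration _ _.
have T0 : 0 < T by lra.
have steps n : limit_df f (- b + n%:R / T) - limit_df f (- b) <= n%:R * Q.
  elim: n => [|n IHn]; first by rewrite !mul0r addr0 subrr.
  have := limit_df_concentration (- b + n%:R / T) (1 / T); rewrite -/Q.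
  have -> : - b + n%:R / T + 1 / T = - b + n.+1%:R / T.
    by rewrite -natr1 mulrDl addrA.
  have -> : n.+1%:R * Q = n%:R * Q + Q by rewrite -natr1 mulrDl mul1r.
  by lra.
(* Enough windows to cover (-b, b]; as T >= 1, there are at most (2b + 1)T of them. *)
set n := (Num.truncn (2 * b * T)).+1.
have n1 : 2 * b * T < n%:R by apply: truncnS_gt.
have n2 : n%:R <= (2 * b + 1) * T.
  have -> : n%:R = (Num.truncn (2 * b * T))%:R + 1 :> R by rewrite natr1.
  have : (Num.truncn (2 * b * T))%:R <= 2 * b * T.
    by rewrite truncn_le; apply: mulr_ge0; lra.
  by rewrite mulrDl mul1r; lra.
have bn : b <= - b + n%:R / T.
  by rewrite addrC lerBrDr ler_pdivlMr //; lra.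
have := steps n; have := limit_df_le bn => H1 H2.
have nQ : 2^-1 <= n%:R * Q by lra.
have Q0 : 0 < Q.
  have n0 : 0 < n%:R :> R by rewrite ltr0n.
  by rewrite -(pmulr_rgt0 _ n0); lra.
rewrite ler_pdivrMr; last by lra.
by nra.
Qed.

End Limit.

(** * Tameness from the convergence hypotheses, and blocks of digit means *)

Lemma series_block_small (R : realType) (u : nat -> R) (eta : R) :
  cvgn (series u) -> 0 < eta ->
  exists s0, forall s t, (s0 <= s)%N -> `|\sum_(s <= j < s + t) u j| <= eta.
Proof.
move=> cu eta0; have eta2 : 0 < eta / 2 by rewrite divr_gt0.
have /cvgrPdist_lt/(_ _ eta2)[s0 _ H] := cu.
exists s0 => s t ss0; rewrite -sub_series_geq ?leq_addr //.
have /ltr_normlP[H1 H2] := H s ss0.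
have /ltr_normlP[H3 H4] := H (s + t)%N (leq_trans ss0 (leq_addr _ _)).
by rewrite ler_norml; apply/andP; split; lra.
Qed.

Lemma digit_sqmean_ge0 (R : realType) (a : nat -> nat) (f : nat -> R) j :
  0 <= digit_sqmean a f j.
Proof.
by rewrite mulr_ge0 ?invr_ge0 ?ler0n //; apply: sumr_ge0 => d _; apply: sqr_ge0.
Qed.

Lemma Q_additive_tame (R : realType) (A : nat) (a : nat -> nat) (f : nat -> R) :
  (forall n, (2 <= a n <= A)%N) -> Q_additive a f ->
  cvgn (series (digit_mean a f)) -> cvgn (series (digit_sqmean a f)) ->
  infinite_set [set p : nat * nat |
    (1 <= p.1 <= (a p.2).-1)%N /\ f (p.1 * cantor_base a p.2)%N != 0] ->
  tame A a f.
Proof.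
move=> hA Qf cm cs inf; have ha n : (2 <= a n)%N by case/andP: (hA n).
have hf := Q_additive_splitting ha Qf.
split=> //.
- move=> eta eta0; have eta2 : 0 < eta / 2 by rewrite divr_gt0.
  have [s1 H1] := series_block_small cm eta2.
  have [s2 H2] := series_block_small cs (exprn_gt0 2 eta2).
  exists (maxn s1 s2) => s t; rewrite geq_max => /andP[ss1 ss2].
  have B1 := H1 s t ss1; have B2 := H2 s t ss2.
  apply: le_trans (avg_norm_block s t ha hf) _.
  have : Num.sqrt (\sum_(s <= j < s + t) digit_sqmean a f j) <= eta / 2.
    rewrite -[leRHS](ger0_norm (ltW eta2)) -sqrtr_sqr ler_wsqrtr //.
    exact: le_trans (ler_norm _) B2.
  by lra.
- move=> s; apply: contrapT => nex; apply: inf.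
  (* If all digit values from [s] on vanished, the nonzero pairs would lie in this finite box. *)
  apply: (@sub_finite_set _ _ (`I_A `*` `I_s)); last exact: finite_setX.
  move=> [d j] /= [/andP[_ da] fd].
  have {}da : (d < a j)%N by rewrite -(ltn_predK (ha j)) ltnS.
  split => /=; first by apply: leq_trans da _; case/andP: (hA j).
  by rewrite ltnNge; apply/negP => sj; apply: nex; exists j, d.
Qed.

Lemma sqr_digit_mean_le (R : realType) (a : nat -> nat) (f : nat -> R) j :
  (forall n, (2 <= a n)%N) -> splitting a f ->
  digit_mean a f j ^+ 2 <= digit_sqmean a f j.
Proof.
move=> ha hf; have a0 : (0 < a j)%N by apply: leq_trans (ha j).
have s0 := digit_sqmean_ge0 a f j.
rewrite -[leRHS]sqr_sqrtr // -[leLHS]real_normK ?num_real // lerXn2r ?nnegrE ?sqrtr_ge0 //.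
rewrite digit_meanE // digit_sqmeanE //; apply: le_trans (avg_norm_le_sqrt _ a0).
rewrite /avg normrM ger0_norm ?invr_ge0 ?ler0n // ler_wpM2l ?invr_ge0 ?ler0n //.
exact: ler_norm_sum.
Qed.

(** Cauchy-Schwarz over the positions [j], then within each digit; this is the origin of the factor
    sqrt(h). *)
Lemma digit_mean_block_le (R : realType) (a : nat -> nat) (f : nat -> R) s n :
  (forall n, (2 <= a n)%N) -> splitting a f -> (0 < n)%N ->
  `|\sum_(s <= j < s + n) digit_mean a f j| <=
  Num.sqrt n%:R * Num.sqrt (\sum_(s <= j < s + n) digit_sqmean a f j).
Proof.
move=> ha hf n0; have nR : 0 < n%:R :> R by rewrite ltr0n.
rewrite !(sum_nat_shift s); apply: le_trans (ler_norm_sum _ _ _) _.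
have := avg_norm_le_sqrt (fun j => digit_mean a f (s + j)%N) n0.
rewrite {1}/avg ler_pdivrMl // => /le_trans; apply.
rewrite -{1}[n%:R]sqr_sqrtr ?ler0n // expr2 -mulrA ler_pM2l ?sqrtr_gt0 //.
rewrite -sqrtrM ?ler0n // ler_wsqrtr // /avg mulrA mulfV ?gt_eqF // mul1r.
by apply: ler_sum => j _; apply: sqr_digit_mean_le.
Qed.

(** * The quantitative bound and the choice of the cut *)

Lemma leq_exp_cantor_base (a : nat -> nat) b t :
  (forall n, (b <= a n)%N) -> (b ^ t <= cantor_base a t)%N.
Proof. by move=> ba; elim: t => //= t IHt; rewrite expnS leq_mul. Qed.

(** [df_compare] with window 1/T and cut s = L - n, followed by the limit in [k]. *)
Lemma df_limit_bound (R : realType) (A b : nat) (a : nat -> nat) (f : nat -> R)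
    (N L n : nat) (T : R)
    (tailmean := limn (fun k => \sum_(L.+1 <= j < k) digit_mean a f j))
    (tailsq := limn (fun k => \sum_(L - n <= j < k) digit_sqmean a f j)) :
  tame A a f -> cvgn (series (digit_mean a f)) -> cvgn (series (digit_sqmean a f)) ->
  (forall n, (b <= a n)%N) -> (cantor_base a L <= N < cantor_base a L.+1)%N ->
  (0 < n <= L)%N -> 1 <= T -> T <= (b ^ n)%:R ->
  forall y, `|empirical_df f N y - limit_df f y| <=
    concentration (limit_df f) (1 / T) + 1 / T +
    (3 * (A%:R + 1)) * (T * `|tailmean| + T * Num.sqrt n%:R * Num.sqrt tailsq).
Proof.
move=> tf cm cs ba LN /andP[n0 nL] T1 Tb y.
have [hA hf _ _] := tf; have ha i : (2 <= a i)%N by case/andP: (hA i).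
have T0 : 0 < T by lra.
have e0 : 0 < 1 / T by rewrite divr_gt0.
set s := (L - n)%N in tailsq *; have sL : (s <= L)%N by apply: leq_subr.
have EL : (s + n.+1)%N = L.+1 by rewrite addnS subnK.
have N0 : 0 < N%:R :> R.
  by rewrite ltr0n; case/andP: LN => + _; apply: leq_trans; apply: cantor_base_gt0.
(* N >= q_L >= q_s b^n >= q_s T. *)
have qN : (cantor_base a s)%:R / N%:R <= 1 / T.
  rewrite ler_pdivrMr // mulrAC ler_pdivlMr // mul1r.
  apply: le_trans (ler_wpM2l (ler0n _ _) Tb) _; rewrite -natrM ler_nat.
  case/andP: LN => + _; apply: leq_trans.
  have -> : L = (s + n)%N by rewrite subnK.
  by rewrite cantor_baseD mulnC leq_mul2r leq_exp_cantor_base ?orbT.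
have cmL : cvgn (fun k => \sum_(L.+1 <= j < k) digit_mean a f j).
  by rewrite is_cvg_series_restrict.
have csS : cvgn (fun k => \sum_(s <= j < k) digit_sqmean a f j).
  by rewrite is_cvg_series_restrict.
have sqS k : \sum_(s <= j < k) digit_sqmean a f j <= tailsq.
  apply: (nondecreasing_cvgn_le _ csS k); apply/nondecreasing_seqP => i.
  have [si|is_] := leqP s i; last by rewrite !big_geq // ltnW.
  by rewrite big_nat_recr //= lerDl digit_sqmean_ge0.
have ssqS k : Num.sqrt (\sum_(s <= j < k) digit_sqmean a f j) <= Num.sqrt tailsq.
  by rewrite ler_wsqrtr.
set r := Num.sqrt n%:R * Num.sqrt tailsq.
have S0 : 0 <= Num.sqrt tailsq by apply: sqrtr_ge0.
have n1 : 1 <= Num.sqrt n%:R :> R by rewrite -[leLHS]sqrtr1 ler_wsqrtr // ler1n.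
have Sr : Num.sqrt tailsq <= r by rewrite ler_peMl.
(* The block from [s] to [L] has n + 1 positions; n >= 1 lets the extra one be absorbed in a factor
   2. *)
have nS : Num.sqrt (n.+1%:R) <= 2 * Num.sqrt n%:R :> R.
  have -> : 2 = Num.sqrt (2 ^+ 2) :> R by rewrite sqrtr_sqr ger0_norm.
  rewrite -sqrtrM ?exprn_ge0 // ler_wsqrtr // -natr1.
  have : 1 <= n%:R :> R by rewrite ler1n.
  by lra.
have head : `|\sum_(s <= j < L.+1) digit_mean a f j| <= 2 * r.
  rewrite -EL; apply: le_trans (digit_mean_block_le s ha hf (ltn0Sn n)) _.
  by rewrite mulrA; apply: ler_pM; rewrite ?sqrtr_ge0.
(* A bound for the error of [df_compare] at finite [k]. Both averages of high parts are at most 3r,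
   up to the means beyond [L] in the second, and the first carries the weight [A]. *)
pose X k := 1 / T + 3 * (A%:R + 1) *
  (T * `|\sum_(L.+1 <= j < k) digit_mean a f j| + T * r).
have cvX : X k @[k --> \oo] --> 1 / T + 3 * (A%:R + 1) * (T * `|tailmean| + T * r).
  apply: cvgD; first exact: cvg_cst.
  apply: cvgMr; apply: cvgD; last exact: cvg_cst.
  by apply: cvgMr; apply: cvg_norm.
have A0 : 0 <= A%:R :> R by rewrite ler0n.
have key k : (L < k)%N ->
  (forall y, empirical_df f N y <=
     avg (cantor_base a k) (fun n => (f n <= y + 1 / T)%R%:R) + X k) /\
  (forall y, avg (cantor_base a k) (fun n => (f n <= y)%R%:R) <=
     empirical_df f N (y + 1 / T) + X k).
  move=> Lk; have sk : (s <= k)%N by apply: leq_trans (ltnW Lk).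
  have [H1 H2] := df_compare hA hf sL sk LN e0.
  have V1 := avg_norm_block s (L.+1 - s) ha hf.
  have V2 := avg_norm_block s (k - s) ha hf.
  rewrite subnKC in V1; last by rewrite ltnW.
  rewrite subnKC // in V2.
  rewrite (big_cat_nat _ (n := L.+1)) //= in V2; last by rewrite ltnW.
  set V := avg _ _ in V1; set W := avg _ _ in V2; rewrite -/V -/W in H1 H2.
  have V1' : V <= 3 * r by have := ssqS L.+1; lra.
  have V2' : W <= 3 * r + `|\sum_(L.+1 <= j < k) digit_mean a f j|.
    by have := ssqS k; have := ler_normD (\sum_(s <= j < L.+1) digit_mean a f j)
      (\sum_(L.+1 <= j < k) digit_mean a f j); lra.
  have DX : (1 / T)^-1 * (A%:R * V + W) + (cantor_base a s)%:R / N%:R <= X k.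
    rewrite [leLHS]addrC; apply: lerD => //; rewrite div1r invrK.
    move: V2'; move: (`|_|) (normr_ge0 (\sum_(L.+1 <= j < k) digit_mean a f j)) => w w0 V2'.
    have -> : 3 * (A%:R + 1) * (T * w + T * r) = T * (3 * (A%:R + 1) * (w + r)) by ring.
    rewrite ler_pM2l //; have := ler_wpM2l A0 V1'.
    by have := mulr_ge0 A0 w0; lra.
  split=> z; rewrite empirical_dfE.
    by apply: le_trans (H1 z) _; rewrite lerD2l.
  by apply: le_trans (H2 z) _; rewrite lerD2l.
have up : empirical_df f N y <= limit_df f (y + 1 / T) +
    (1 / T + 3 * (A%:R + 1) * (T * `|tailmean| + T * r)).
  apply: (cvgr_to_ge (cvgD (@cvg_df_cantor_base _ _ _ _ tf (y + 1 / T)) cvX)).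
  by exists L.+1 => // k /= Lk; case: (key k Lk) => + _; apply.
have down : limit_df f (y - 1 / T) <= empirical_df f N y +
    (1 / T + 3 * (A%:R + 1) * (T * `|tailmean| + T * r)).
  apply: (ler_cvg_to (@cvg_df_cantor_base _ _ _ _ tf (y - 1 / T))
    (cvgD (cvg_cst (empirical_df f N y)) cvX)).
  exists L.+1 => // k /= Lk; case: (key k Lk) => _ /(_ (y - 1 / T)).
  by rewrite subrK.
have C1 := limit_df_concentration tf y (1 / T).
have C2 := limit_df_concentration tf (y - 1 / T) (1 / T).
rewrite subrK in C2.
have -> : T * Num.sqrt n%:R * Num.sqrt tailsq = T * r by rewrite -mulrA.
by rewrite ler_norml; apply/andP; split; lra.
Qed.

(** For T >= e one has ln T >= 1, so T <= T ln T <= b^n; as T ln T > 1, the ceiling is positive. *)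
Lemma cut_lengthP (R : realType) (b : nat) (T : R) : (2 <= b)%N -> expR 1 <= T ->
  exists2 n : nat, (0 < n)%N & cut_length b T = n%:Z /\ T <= (b ^ n)%:R.
Proof.
move=> b2 eT; have T0 : 0 < T by apply: lt_le_trans eT; apply: expR_gt0.
have lnT : 1 <= ln T by rewrite -[leLHS]expRK ler_ln ?posrE ?expR_gt0.
have e1 : 1 < expR 1 :> R by rewrite expR_gt1.
have TT : T <= T * ln T by rewrite ler_peMr // ltW.
have TT1 : 1 < T * ln T by lra.
have lnb : 0 < ln (b%:R : R) by rewrite ln_gt0 // ltr1n.
have : 0 < cut_length b T by rewrite ceil_gt0 divr_gt0 // ln_gt0.
have : ln (T * ln T) / ln (b%:R : R) <= (cut_length b T)%:~R by apply: ceil_ge.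
case: (cut_length b T) => // n H n0; exists n => //; split => //.
apply: le_trans TT _; move: H; rewrite ler_pdivrMr // -pmulrn mulr_natl.
have b0 : 0 < b%:R :> R by rewrite ltr0n (leq_trans _ b2).
rewrite -lnXn // ler_ln ?posrE ?exprn_gt0 //; last by lra.
by rewrite natrX.
Qed.

(** * The final estimate and its constants *)

Theorem theorem6 (R : realType) (amin amax : nat) :
  exists C : R, forall f : nat -> R, exists K : R, forall a : nat -> nat,
  (forall n, (2 <= a n)%N) -> is_seq_min a amin -> is_seq_max a amax ->
  Q_additive a f ->
  cvgn (series (digit_mean a f)) ->
  cvgn (series (digit_sqmean a f)) ->
  infinite_set [set p : nat * nat |
    (1 <= p.1 <= (a p.2).-1)%N /\ f (p.1 * cantor_base a p.2)%N != 0] ->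
  forall (N : nat) (T : R), (1 <= N)%N -> 1 <= T ->
  let L := top_index a N in
  let h := cut_length amin T in
  h <= L%:Z ->
  sup_norm (fun y => empirical_df f N y - limit_df f y) <=
    K * concentration (limit_df f) (1 / T)
    + C * (T * `|\big[+%R/0]_(L.+1 <= j <oo)
                   ((a j)%:R^-1 * \sum_(0 <= d < a j) f (d * cantor_base a j)%N)|
           + T * Num.sqrt h%:~R *
             Num.sqrt (\big[+%R/0]_(`|L%:Z - h|%N <= j <oo)
                   ((a j)%:R^-1 * \sum_(0 <= d < a j) f (d * cantor_base a j)%N ^+ 2))).
Proof.
exists (3 * (amax%:R + 1)) => f.
(* [K] is fixed before the bases are known. This is possible because [limit_df f] involves [f]
   alone: either some lower constant [c] exists for it and determines [K], or none does and any
   value will do. *)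
have [K HK] : exists K : R, forall c : R, 0 < c ->
    (forall T, 1 <= T -> c <= T * concentration (limit_df f) (1 / T)) ->
    forall T, 1 <= T ->
    concentration (limit_df f) (1 / T) + expR 1 / T <=
    K * concentration (limit_df f) (1 / T).
  have [[c [c0 Hc]]|nc] := pselect (exists c : R, 0 < c /\
      forall T, 1 <= T -> c <= T * concentration (limit_df f) (1 / T)).
    exists (1 + expR 1 / c) => _ _ _ T T1; have T0 : 0 < T by lra.
    move: (Hc T T1); move: (concentration _ _) => Q cQ.
    rewrite mulrDl mul1r lerD2l -mulrA ler_pM2l ?expR_gt0 //.
    by rewrite -div1r ler_pdivrMr // -mulrA ler_pdivlMl // mulr1 mulrC.
  by exists 0 => c c0 Hc; case: nc; exists c.
exists K => a ha [[i ai] amina] [_ aamax] Qf cm cs inf N T N1 T1 L h hL.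
have hA n : (2 <= a n <= amax)%N by rewrite ha aamax.
have tf := Q_additive_tame hA Qf cm cs inf.
have hf := Q_additive_splitting ha Qf.
have [c c0 Hc] := concentration_lower tf.
have {HK} HK := HK c c0 Hc T T1; have T0 : 0 < T by lra.
have -> : \big[+%R/0]_(L.+1 <= j <oo) ((a j)%:R^-1 *
      \sum_(0 <= d < a j) f (d * cantor_base a j)%N) =
    limn (fun k => \sum_(L.+1 <= j < k) digit_mean a f j).
  by congr (limn _); apply/funext => k; apply: eq_bigr => j _; rewrite digit_meanE.
set M := \big[+%R/0]_(L.+1 <= j <oo) _; set S := \big[+%R/0]_(_ <= j <oo) _.
apply: ge_sup; first by exists `|empirical_df f N 0 - limit_df f 0|; exists 0.
move=> _ [y _ <-].
have amin2 : (2 <= amin)%N by rewrite -ai ha.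
(* For T < e the cut length may be nonpositive, but then e/T >= 1 already bounds the left side; this
   is why e/T, and not just 1/T, was absorbed into the concentration. *)
have [eT|Te] := leP (expR 1) T; last first.
  have le1 : `|empirical_df f N y - limit_df f y| <= 1.
    have := limit_df_ge0 tf y; have := limit_df_le1 tf y.
    have := empirical_df_ge0 f N y; have := empirical_df_le1 f N y.
    by rewrite ler_norml => *; apply/andP; split; lra.
  have e1 : 1 <= expR 1 / T by rewrite ler_pdivlMr // mul1r ltW.
  have C0 : 0 <= 3 * (amax%:R + 1) * (T * `|M| + T * Num.sqrt h%:~R * Num.sqrt S).
    by rewrite !(mulr_ge0, addr_ge0) ?sqrtr_ge0 // ltW.
  have := Hc T T1; rewrite -ler_pdivrMl // => Q0.
  have : 0 <= T^-1 * c by apply: mulr_ge0; [rewrite invr_ge0|]; exact: ltW.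
  by lra.
have [n n0 [hn Tb]] := cut_lengthP amin2 eT.
have nL : (n <= L)%N by move: hL; rewrite /h hn lez_nat.
have SE : S = limn (fun k => \sum_(L - n <= j < k) digit_sqmean a f j).
  rewrite /S /h hn; have -> : `|L%:Z - n%:Z|%N = (L - n)%N by rewrite subzn.
  by congr (limn _); apply/funext => k; apply: eq_bigr => j _; rewrite digit_sqmeanE.
rewrite SE /h hn -pmulrn.
have nL' : (0 < n <= L)%N by rewrite n0.
have := df_limit_bound tf cm cs amina (top_indexP ha N1) nL' T1 Tb y.
have : 1 / T <= expR 1 / T.
  by rewrite ler_pM2r ?invr_gt0 // ltW // expR_gt1.
by rewrite -/L -/M; lra.
Qed.
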